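(* The only solution of the equation $$2^{14}\cdot 3^2\cdot 11\cdot 443\, d^2 = 5^2 L^3 + 2^5\cdot 3^2 L^2 + 2^8\cdot 5\, L + 2^{16}\cdot 3\cdot 11$$ with $L \in {\mathbb Z}$ and $d \in {\mathbb Q}$ is $L = -48$, $d = 0$. *)

(* Defs.v *)
From mathcomp Require Import all_boot all_algebra.

(* Main.v *)
Require Import Defs.
From mathcomp Require Import all_boot all_algebra.
From mathcomp Require Import zify ssrZ.
From Stdlib Require Import ZArith Znumtheory List Lia.
Import GRing.Theory Num.Theory.

(* With [M = L + 48] and [D = 384 d] the equation reads
   [11 * 443 * D^2 = M (25 M^2 - 3312 M + 146432)], an integral point problem on
   an elliptic curve with a rational 2-torsion point.  Descent gives [M = a u^2]
   and [25 M^2 - 3312 M + 146432 = b v^2] for sixteen pairs [(a, b)]; seven die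
   modulo 121 or 443.  For the others, after removing powers of 2, a second
   descent uses a tangent to the conic [q(x) = b v^2] at a rational point: its
   value at an integral point is, up to squares, one of finitely many integers,
   each of which is excluded modulo a small number.  Two pairs resist.
   For [(9746, 2)] all solutions of the Pell equation [X^2 - 2 Y^2 = -14351]
   lie in finitely many orbits of a unit, and their classes modulo 35 are
   incompatible with [X = 50 * 9746 k^2 - 207].  For [(5759, 143)], which
   contains the solution [M = 0], further descents lead to
   [s (4 x - 207 s) = 4873 j^2] with [x^2 - 3575 s^2 = 1]; if [x] is odd,
   halving in the group of units produces ever smaller solutions whose first
   coordinate is a square, and if [x] is even the equation dies modulo small
   numbers. *)

Local Open Scope Z_scope.

(** * Solubility modulo m *)

Definition cong (m x y : Z) : Prop := Z.divide m (x - y).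

Lemma cong_refl m x : cong m x x.
Proof. exists 0; lia. Qed.

Lemma cong_mod m x : 0 < m -> cong m x (x mod m).
Proof. move=> m0; exists (x / m); have := Z.div_mod x m; lia. Qed.

Lemma cong_add m x y x' y' :
  cong m x x' -> cong m y y' -> cong m (x + y) (x' + y').
Proof. move=> [k hk] [l hl]; exists (k + l); lia. Qed.

Lemma cong_sub m x y x' y' :
  cong m x x' -> cong m y y' -> cong m (x - y) (x' - y').
Proof. move=> [k hk] [l hl]; exists (k - l); lia. Qed.

Lemma cong_mul m x y x' y' :
  cong m x x' -> cong m y y' -> cong m (x * y) (x' * y').
Proof.
move=> [k hk] [l hl]; exists (k * y + x' * l).
by rewrite Z.mul_add_distr_r -(Z.mul_assoc x') -hl; nia.
Qed.

Lemma cong_sqr m x x' : cong m x x' -> cong m (x ^ 2) (x' ^ 2).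
Proof. by move=> h; rewrite !Z.pow_2_r; apply: cong_mul. Qed.

Ltac congruence_mod :=
  repeat intro; cbv beta;
  repeat match goal with
  | |- cong _ ?x ?x => apply: cong_refl
  | |- cong _ (_ + _) (_ + _) => apply: cong_add
  | |- cong _ (_ - _) (_ - _) => apply: cong_sub
  | |- cong _ (_ * _) (_ * _) => apply: cong_mul
  | |- cong _ (_ ^ 2) (_ ^ 2) => apply: cong_sqr
  | |- cong _ _ _ => assumption
  end.

Definition residues (m : Z) : list Z :=
  map Z.of_nat (List.seq 0 (Z.to_nat m)).

Lemma in_residues m x : 0 <= x < m -> In x (residues m).
Proof.
move=> hx; apply/in_map_iff; exists (Z.to_nat x); split; first lia.
by apply/in_seq; lia.
Qed.

Lemma mod_residues m x : 0 < m -> In (x mod m) (residues m).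
Proof. by move=> m0; apply/in_residues/Z.mod_pos_bound. Qed.

(* [find] stops at the first hit; [forallb] and [existsb] always run through
   the whole list under [vm_compute]. *)
Definition for_all (f : Z -> bool) (l : list Z) : bool :=
  if find (fun x => negb (f x)) l is None then true else false.

Definition for_some (f : Z -> bool) (l : list Z) : bool :=
  if find f l is None then false else true.

Lemma for_allP f l x : for_all f l = true -> In x l -> f x = true.
Proof.
rewrite /for_all; case e : (find _ l) => // _ hx.
by have := find_none _ _ e x hx; case: (f x).
Qed.

Lemma for_someP f l : for_some f l = true -> exists x, In x l /\ f x = true.
Proof.
rewrite /for_some; case e : (find _ l) => [x|] // _.
by exists x; apply: find_some.
Qed.

(** [h] fixes the shape of the first unknown, such as [a * u ^ 2]. Its residues are deduplicated,
    and the third unknown is searched only at zeros of [f], which keeps the enumeration small. *)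
Definition insoluble (m : Z) (h : Z -> Z) (f : Z -> Z -> Z)
    (g : Z -> Z -> Z -> Z) : bool :=
  let R := residues m in
  for_all (fun x => for_all (fun y =>
    if f x y mod m =? 0 then for_all (fun z => negb (g x y z mod m =? 0)) R
    else true) R)
  (nodup Z.eq_dec (map (fun u => h u mod m) R)).

Lemma insolubleP m h f g : 0 < m ->
  (forall u u', cong m u u' -> cong m (h u) (h u')) ->
  (forall x x' y y', cong m x x' -> cong m y y' ->
     cong m (f x y) (f x' y')) ->
  (forall x x' y y' z z', cong m x x' -> cong m y y' -> cong m z z' ->
     cong m (g x y z) (g x' y' z')) ->
  insoluble m h f g = true ->
  forall u y z, f (h u) y = 0 -> g (h u) y z = 0 -> False.
Proof.
have mod0 a b : 0 < m -> cong m a b -> a = 0 -> (b mod m =? 0) = true.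
  move=> m0 [k hk] a0; apply/Z.eqb_eq.
  have -> : b = - k * m by lia.
  by apply: Z.mod_mul; lia.
move=> m0 hh hf hg chk u y z f0 g0.
have hx : cong m (h u) (h (u mod m) mod m).
  have [k hk] : cong m (h u) (h (u mod m)) by apply: hh; apply: cong_mod.
  have [l hl] := cong_mod m (h (u mod m)) m0.
  by exists (k + l); lia.
have hin : In (h (u mod m) mod m)
    (nodup Z.eq_dec (map (fun u => h u mod m) (residues m))).
  apply/nodup_In/in_map_iff; exists (u mod m); split => //.
  exact: mod_residues.
have := for_allP _ _ _ (for_allP _ _ _ chk hin) (mod_residues m y m0).
rewrite (mod0 _ _ m0 (hf _ _ _ _ hx (cong_mod m y m0)) f0) => chk'.
have := for_allP _ _ _ chk' (mod_residues m z m0).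
by rewrite (mod0 _ _ m0 (hg _ _ _ _ _ _ hx (cong_mod m y m0)
  (cong_mod m z m0)) g0).
Qed.

(** * Square classes *)

(** For distinct primes [ps] these products represent the positive square classes supported on
    [ps]. *)
Fixpoint subprods (ps : list Z) : list Z :=
  if ps is p :: ps' then subprods ps' ++ map (Z.mul p) (subprods ps')
  else [:: 1].

Lemma subprods_cons q ps l : In l (subprods (q :: ps)) <->
  In l (subprods ps) \/ exists l0, l = q * l0 /\ In l0 (subprods ps).
Proof.
rewrite [subprods _]/= in_app_iff in_map_iff.
by split=> -[|[l0 [? ?]]]; [left | right; exists l0 | left | right; exists l0].
Qed.

(** Up to squares, multiplication by [p] toggles the presence of [p] in the product. *)
Lemma subprods_mul ps p l : In p ps -> In l (subprods ps) ->
  exists l' k, In l' (subprods ps) /\ p * l = l' * k ^ 2.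
Proof.
elim: ps l => [//|q ps IH] l [->|hp] /subprods_cons[hl|[l0 [-> hl]]].
- exists (p * l), 1; split; last ring.
  by apply/subprods_cons; right; exists l.
- exists l0, p; split; last ring.
  by apply/subprods_cons; left.
- have [l' [k [hl' e]]] := IH _ hp hl.
  by exists l', k; split=> //; apply/subprods_cons; left.
- have [l' [k [hl' e]]] := IH _ hp hl.
  exists (q * l'), k; split; last by rewrite -Z.mul_assoc -e; ring.
  by apply/subprods_cons; right; exists l'.
Qed.

Lemma one_subprods ps : In 1 (subprods ps).
Proof. by elim: ps => [|q ps IH] /=; [left | apply/in_app_iff; left]. Qed.

Lemma prime_divisor_exists x : 1 < x -> exists p, prime p /\ Z.divide p x.
Proof.
move=> x1; have x0 : 0 <= x by lia.
move: x x0 x1; apply: Z_lt_induction => x IH x1.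
case: (prime_dec x) => hx; first by exists x; split=> //; exists 1; lia.
have [n [hn dn]] := not_prime_divide x x1 hx.
have [p [pp dp]] := IH n ltac:(lia) ltac:(lia).
by exists p; split=> //; apply: Z.divide_trans dp dn.
Qed.

(* Only the primes dividing both [x] and [y * c] can divide [x] to an odd
   power. *)
Lemma square_class ps x y c w : 0 < x ->
  (forall p, prime p -> Z.divide p x -> Z.divide p (y * c) -> In p ps) ->
  x * y = c * w ^ 2 -> exists l t, In l (subprods ps) /\ x = l * t ^ 2.
Proof.
move=> x0; have x0' : 0 <= x by lia.
move: x x0' x0 y w; apply: Z_lt_induction => x IH x0 y w hps e.
case: (Z.eq_dec x 1) => [->|x1].
  by exists 1, 1; split; [apply: one_subprods | lia].
have [p [pp [x1' ex]]] := prime_divisor_exists x ltac:(lia).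
have p2 := prime_ge_2 p pp.
(* If [p] divides [y * c], it moves from [x] to [y] and is toggled in the class. Otherwise it
   divides [w], and [p ^ 2] is removed from [x]. *)
case: (Zdivide_dec p (y * c)) => hp.
  have inp : In p ps by apply: hps => //; exists x1'.
  have e1 : x1' * (p * y) = c * w ^ 2 by rewrite -e ex; ring.
  have [|l [t [hl et]]] := IH x1' ltac:(nia) ltac:(nia) (p * y) w _ e1.
    move=> q pq dx; rewrite -Z.mul_assoc => /(prime_mult _ pq)[dp|dy].
      by rewrite (prime_div_prime q p pq pp dp).
    by apply: hps => //; rewrite ex; apply: Z.divide_mul_l.
  have [l' [k [hl' ek]]] := subprods_mul ps p l inp hl.
  exists l', (k * t); split=> //.
  by rewrite ex et Z.mul_comm Z.mul_assoc ek; ring.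
have ndy : ~ Z.divide p y by move=> d; apply: hp; apply: Z.divide_mul_l.
have ndc : ~ Z.divide p c by move=> d; apply: hp; apply: Z.divide_mul_r.
have [//|[w1 ew]] : Z.divide p c \/ Z.divide p w.
  have : Z.divide p (c * w ^ 2) by exists (x1' * y); nia.
  by rewrite Z.pow_2_r => /(prime_mult _ pp)[|/(prime_mult _ pp)[|]]; auto.
have e1 : x1' * y = c * p * w1 ^ 2 by nia.
have [[x2 ex2]|//] : Z.divide p x1' \/ Z.divide p y.
  by apply: prime_mult => //; exists (c * w1 ^ 2); lia.
have pp4 : 4 <= p * p by nia.
have hx : x = x2 * (p * p) by rewrite ex ex2; ring.
have x20 : 0 < x2 by nia.
have lt2 : x2 < x by nia.
have e2 : x2 * y = c * w1 ^ 2.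
  by apply: (Z.mul_reg_r _ _ p); [lia | rewrite -Z.mul_assoc; lia].
have [|l [t [hl et]]] := IH x2 ltac:(lia) x20 y w1 _ e2.
  move=> q pq dx dyc; apply: hps => //.
  by rewrite hx; apply: Z.divide_mul_l.
by exists l, (p * t); split=> //; rewrite hx et; ring.
Qed.

Lemma abs_sqr x : Z.abs x ^ 2 = x ^ 2.
Proof. by case: (Z.abs_spec x) => -[_ ->]; ring. Qed.

Lemma sqr_inj x y : 0 <= x -> 0 <= y -> x ^ 2 = y ^ 2 -> x = y.
Proof. by nia. Qed.

(** In lowest terms the denominator of [w / s] divides the numerator, hence is 1 or -1. *)
Lemma square_quotient x s w : s <> 0 -> x * s ^ 2 = w ^ 2 ->
  exists r, 0 <= r /\ x = r ^ 2.
Proof.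
move=> s0 e; have g0 : Z.gcd s w <> 0 by move/Z.gcd_eq_0_l.
have cop := Z.gcd_div_gcd s w _ g0 erefl.
have [s1 es] := Z.gcd_divide_l s w; have [w1 ew] := Z.gcd_divide_r s w.
set g := Z.gcd s w in g0 cop es ew.
have es1 : s / g = s1 by rewrite {1}es Z.div_mul.
have ew1 : w / g = w1 by rewrite {1}ew Z.div_mul.
rewrite es1 ew1 in cop.
have e1 : x * s1 ^ 2 = w1 ^ 2.
  apply: (Z.mul_reg_r _ _ (g ^ 2)); first nia.
  have -> : x * s1 ^ 2 * g ^ 2 = x * (s1 * g) ^ 2 by ring.
  by rewrite -es e ew; ring.
have dw : Z.divide s1 w1.
  by apply: (Z.gauss s1 w1 w1) => //; exists (x * s1);
    rewrite -Z.pow_2_r -e1; ring.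
have s11 : s1 = 1 \/ s1 = - 1.
  by apply: Z.divide_1_r; rewrite -cop; apply: Z.gcd_greatest => //; exists 1; lia.
exists (Z.abs w1); split; first exact: Z.abs_nonneg.
by rewrite abs_sqr -e1; case: s11 => ->; ring.
Qed.

(** The filter keeps the pairs with [c * l1 * l2] a square, as
    [l1 * s ^ 2 * (l2 * t ^ 2) = c * w ^ 2] demands for nonzero [s] and [t]. *)
Definition class_pairs (c : Z) (ps : list Z) : list (Z * Z) :=
  List.filter (fun l => Z.sqrt (c * l.1 * l.2) ^ 2 =? c * l.1 * l.2)
    (list_prod (subprods ps) (subprods ps)).

(** The last equation is the square root of [c * l1 * l2 * (s * t) ^ 2 = (c * w) ^ 2]; the Pell
    descents recover [s * t] from it. *)
Lemma square_classes ps x y c w : 0 < x -> 0 < y -> 0 < c ->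
  (forall p, prime p -> Z.divide p c -> In p ps) ->
  (forall p, prime p -> Z.divide p x -> Z.divide p y -> In p ps) ->
  x * y = c * w ^ 2 ->
  exists l1 l2 s t, In (l1, l2) (class_pairs c ps) /\ 0 < s /\ 0 < t /\
    x = l1 * s ^ 2 /\ y = l2 * t ^ 2 /\
    Z.sqrt (c * l1 * l2) * (s * t) = c * Z.abs w.
Proof.
move=> x0 y0 c0 hc hxy e.
have [p pp dx /(prime_mult _ pp)[dy|/hc]|l1 [s [h1 ex]]] :=
  square_class ps x y c w x0 _ e; auto.
have [p pp dy /(prime_mult _ pp)[dx|/hc]||l2 [t [h2 ey]]] :=
  square_class ps y x c w y0 _ _; auto; first by rewrite Z.mul_comm.
have l10 : 0 < l1 by nia.
have l20 : 0 < l2 by nia.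
have s0 : s <> 0 by nia.
have t0 : t <> 0 by nia.
have ecw : c * l1 * l2 * (s * t) ^ 2 = (c * w) ^ 2.
  have -> : (c * w) ^ 2 = c * (c * w ^ 2) by ring.
  by rewrite -e ex ey; ring.
have [|r [r0 er]] := square_quotient _ (s * t) _ _ ecw.
  exact/Z.neq_mul_0.
have esq : Z.sqrt (c * l1 * l2) = r.
  by rewrite er Z.pow_2_r Z.sqrt_square.
exists l1, l2, (Z.abs s), (Z.abs t); split.
  apply/filter_In; split; first exact/in_prod.
  by rewrite [(_, _).1]/= [(_, _).2]/= esq er; apply: Z.eqb_refl.
do 2 (split; first exact/Z.abs_pos).
rewrite !abs_sqr; do 2 split=> //.
rewrite esq; apply: sqr_inj.
- apply: Z.mul_nonneg_nonneg => //.
  exact: Z.mul_nonneg_nonneg (Z.abs_nonneg s) (Z.abs_nonneg t).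
- exact: Z.mul_nonneg_nonneg (Z.lt_le_incl _ _ c0) (Z.abs_nonneg w).
rewrite !Z.pow_mul_l !abs_sqr -!Z.pow_mul_l -ecw er.
by rewrite !Z.pow_mul_l.
Qed.

Definition primeb (p : Z) : bool :=
  (1 <? p) &&
  for_all (fun d => (d <=? 1) || negb (p mod d =? 0)) (residues p).

Lemma primebP p : primeb p = true -> prime p.
Proof.
move=> /andP[/Z.ltb_lt p1 chk].
apply/prime_alt; split=> // n hn dn.
have hin : In n (residues p) by apply: in_residues; lia.
have := for_allP _ _ _ chk hin.
by rewrite (Zdivide_mod _ _ dn) orbF => /Z.leb_le; lia.
Qed.

Lemma prime_ndvd1 p : prime p -> ~ Z.divide p 1.
Proof. by move=> /prime_ge_2 p2 /Z.divide_1_r; lia. Qed.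

(** If [n] divides a power of the product of [ps], its primes lie in [ps]; the exponent 20 suffices
    for the numbers tested. *)
Definition supported (ps : list Z) (n : Z) : bool :=
  for_all primeb ps && (fold_right Z.mul 1 ps ^ 20 mod n =? 0).

Lemma supportedP ps n p : supported ps n = true -> n <> 0 ->
  prime p -> Z.divide p n -> In p ps.
Proof.
move=> /andP[/for_allP hps /Z.eqb_eq hn] n0 pp dn.
have hd : Z.divide p (fold_right Z.mul 1 ps ^ 20).
  by apply: Z.divide_trans dn _; apply: Zmod_divide.
have root k : Z.divide p (fold_right Z.mul 1 ps ^ Z.of_nat k) ->
    Z.divide p (fold_right Z.mul 1 ps).
  elim: k => [|k IH]; first by move=> /(prime_ndvd1 _ pp).
  by rewrite Nat2Z.inj_succ Z.pow_succ_r; last lia; case/(prime_mult _ pp).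
have {}hd := root 20%nat hd.
elim: ps hps hd {hn root} => [|q ps IH] hps /=.
  by move=> /(prime_ndvd1 _ pp).
case/(prime_mult _ pp) => [dq|dps]; last first.
  by right; apply: IH => // r hr; apply: hps; right.
left; apply/esym/prime_div_prime => //.
by apply/primebP/hps; left.
Qed.

(** * The tangent obstruction *)

(* A prime dividing both [L] and [L'] divides [2 b v0] or [v]; in the latter
   case it divides [D] or [w], hence [b v0^2]. *)
Lemma tangent_class ps D b v0 v w i j L L' :
  0 < D -> 0 < b -> 0 < v0 -> 0 <= v ->
  supported ps (2 * D * b * v0) = true ->
  (- L) * L' = D * w ^ 2 -> L' - L = 4 * b * v0 * v ->
  b * v0 ^ 2 = v * i - w * j ->
  exists l t, In l (subprods ps) /\ - L = l * t ^ 2.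
Proof.
move=> D0 b0 v00 v1 hps eL sL ij.
case: (Z.eq_dec L 0) => [->|L0].
  by exists 1, 0; split; [apply: one_subprods | ].
have n0 : 2 * D * b * v0 <> 0.
  by do 3 (apply/Z.neq_mul_0; split; [ | lia]); lia.
have inps p d : prime p -> Z.divide p d -> Z.divide d (2 * D * b * v0) ->
    In p ps.
  by move=> pp dp dd; apply: supportedP hps n0 pp _; apply: Z.divide_trans dd.
have L1 : 0 < - L.
  have sL0 : 0 <= L' - L.
    by rewrite sL; do 2 (apply: Z.mul_nonneg_nonneg; last lia); lia.
  have eL0 : 0 <= (- L) * L'.
    rewrite eL; apply: Z.mul_nonneg_nonneg; first lia.
    by apply: Z.pow_even_nonneg; exists 1.
  by clear - L0 sL0 eL0; nia.
apply: (square_class ps (- L) L' D w) => // p pp dL /(prime_mult _ pp)[dL'|dD];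
  last by apply: (inps p D) => //; exists (2 * b * v0); ring.
have : Z.divide p (2 * 2 * b * v0 * v).
  have -> : 2 * 2 * b * v0 * v = L' + (- L) by rewrite Z.add_opp_r sL; ring.
  exact: Z.divide_add_r.
move=> /(prime_mult _ pp)[/(prime_mult _ pp)[/(prime_mult _ pp)[|]|]|].
- by move=> /(prime_mult _ pp)[] d2; apply: (inps p 2) => //;
    exists (D * b * v0); ring.
- by move=> db; apply: (inps p b) => //; exists (2 * D * v0); ring.
- by move=> dv; apply: (inps p v0) => //; exists (2 * D * b); ring.
move=> dv; have : Z.divide p (D * (w * w)).
  by rewrite -Z.pow_2_r -eL; apply: Z.divide_mul_l.
move=> /(prime_mult _ pp)[dD|dw].
  by apply: (inps p D) => //; exists (2 * b * v0); ring.
have {}dw : Z.divide p w by case/(prime_mult _ pp): dw.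
have : Z.divide p (b * (v0 * v0)).
  by rewrite -Z.pow_2_r ij; apply: Z.divide_sub_r; apply: Z.divide_mul_l.
move=> /(prime_mult _ pp)[db|].
  by apply: (inps p b) => //; exists (2 * D * v0); ring.
by move=> /(prime_mult _ pp)[] d0; apply: (inps p v0) => //;
  exists (2 * D * b); ring.
Qed.

(** Polar form of the conic [A x^2 + B x y + C y^2 = b v^2] at [(x0, y0, v0)], evaluated at
    [(x, 1, v)]. *)
Definition tangent (A B C b x0 y0 v0 x v : Z) : Z :=
  2 * A * x0 * x + B * (y0 * x + x0) + 2 * C * y0 - 2 * b * v0 * v.

Definition obstructed (A B C b : Z) (h : Z -> Z) (x0 y0 v0 : Z)
    (ps ms : list Z) : bool :=
  [&& A * x0 ^ 2 + B * x0 * y0 + C * y0 ^ 2 =? b * v0 ^ 2,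
      0 <? b, 0 <? v0, 0 <? 4 * A * C - B ^ 2,
      supported ps (2 * (4 * A * C - B ^ 2) * b * v0) &
      for_all (fun l => for_some (fun m => (0 <? m) &&
        insoluble m h (fun x v => A * x ^ 2 + B * x + C - b * v ^ 2)
          (fun x v t => tangent A B C b x0 y0 v0 x v + l * t ^ 2)) ms)
        (subprods ps)].

(* On the conic [q(x, 1) = b v^2] the product of the tangent forms at
   [(x0, y0, v0)] and at [(x0, y0, - v0)] is [- D (x y0 - x0)^2] with
   [D = 4 A C - B^2]; they have no common factor beyond [2 D b v0], so each
   takes, up to sign, only finitely many values modulo squares. *)
Lemma obstructedP A B C b h x0 y0 v0 ps ms :
  (forall m u u', cong m u u' -> cong m (h u) (h u')) ->
  obstructed A B C b h x0 y0 v0 ps ms = true ->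
  forall u v, A * h u ^ 2 + B * h u + C = b * v ^ 2 -> False.
Proof.
move=> hh /and5P[/Z.eqb_eq e0 /Z.ltb_lt b0 /Z.ltb_lt v00 /Z.ltb_lt D0].
move=> /andP[hps /for_allP chk] u v.
(* For [v >= 0] the two tangent values satisfy [L <= L'], which forces [L <= 0], so that [- L] falls
   in a positive class. *)
wlog v1 : v / 0 <= v.
  by move=> H e; apply: (H (Z.abs v)); [lia | rewrite abs_sqr].
move=> e; set x := h u in e.
set D := 4 * A * C - B ^ 2 in D0 hps.
set L := tangent A B C b x0 y0 v0 x v.
set L' := tangent A B C b x0 y0 (- v0) x v.
have [l [t [hl et]]] : exists l t, In l (subprods ps) /\ - L = l * t ^ 2.
  (* The cofactors come from dividing [y0^2 q(x, 1) - q(x0, y0)] by [x * y0 - x0]. *)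
  apply: (tangent_class ps D b v0 v (x * y0 - x0) (y0 ^ 2 * b * v)
    (A * (x * y0 + x0) + B * y0) L L') => //.
  - have -> : (- L) * L' = 4 * (b * v0 ^ 2) * (b * v ^ 2)
        - (2 * A * x0 * x + B * (y0 * x + x0) + 2 * C * y0) ^ 2.
      by rewrite /L /L' /tangent; ring.
    by rewrite -e -e0 /D; ring.
  - by rewrite /L /L' /tangent; ring.
  have -> : v * (y0 ^ 2 * b * v) = y0 ^ 2 * (b * v ^ 2) by ring.
  by rewrite -e -e0; ring.
have /for_someP[m [_ /andP[/Z.ltb_lt m0 ins]]] := chk l hl.
apply: (insolubleP _ _ _ _ m0 _ _ _ ins u v t).
- exact: hh.
- by congruence_mod.
- by move=> *; rewrite /tangent; congruence_mod.
- by rewrite -/x e Z.sub_diag.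
- by rewrite -/x -/L -et Z.add_opp_diag_r.
Qed.

(** * Elimination of fourteen of the sixteen classes *)

Lemma no_roots m h f : 0 < m ->
  (forall u u', cong m u u' -> cong m (h u) (h u')) ->
  (forall x x' y y', cong m x x' -> cong m y y' ->
     cong m (f x y) (f x' y')) ->
  insoluble m h f (fun _ _ _ => 0) = true ->
  forall u y, f (h u) y = 0 -> False.
Proof.
move=> m0 hh hf chk u y f0.
by apply: (insolubleP _ _ _ _ m0 hh hf _ chk u y 0 f0) => // *; apply: cong_refl.
Qed.

Lemma halve b v n : b mod 4 <> 0 -> b * v ^ 2 = 4 * n ->
  exists v', v = 2 * v' /\ b * v' ^ 2 = n.
Proof.
move=> hb; case: (Z.Even_or_Odd v) => -[k ->] e; first by exists k; lia.
case: hb; have -> : b = (n - b * (k ^ 2 + k)) * 4 by lia.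
exact: Z_mod_mult.
Qed.

(** The cases are [u] odd, [u] twice an odd number, and [u] divisible by 4. Each factor 2 in [u]
    makes the left side divisible by 16, and the condition on [b] lets [v] absorb it. The form
    [+ - 3312 * x] matches [A * x ^ 2 + B * x + C]. *)
Lemma two_adic_cases a b u v : b mod 4 <> 0 ->
  25 * (a * u ^ 2) ^ 2 - 3312 * (a * u ^ 2) + 146432 = b * v ^ 2 ->
  (exists k, let x := a * (2 * k + 1) ^ 2 in
    25 * x ^ 2 + - 3312 * x + 146432 = b * v ^ 2) \/
  (exists k v', let x := a * (2 * k + 1) ^ 2 in
    25 * x ^ 2 + - 828 * x + 9152 = b * v' ^ 2) \/
  (exists k v', u = 4 * k /\ let x := a * k ^ 2 in
    25 * x ^ 2 + - 207 * x + 572 = b * v' ^ 2).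
Proof.
move=> hb; case: (Z.Even_or_Odd u) => -[k ->] e; last first.
  by left; exists k; cbv zeta; lia.
have {e} e : b * v ^ 2 = 4 * (4 * (25 * (a * k ^ 2) ^ 2 - 828 * (a * k ^ 2) + 9152)).
  by rewrite -e; ring.
have {e} [v1 [_ e]] := halve _ _ _ hb e.
have {e} [v2 [_ e]] := halve _ _ _ hb e.
case: (Z.Even_or_Odd k) e => -[j ->] e; right; last first.
  by left; exists j, v2; cbv zeta; lia.
have {e} e : b * v2 ^ 2 = 4 * (4 * (25 * (a * j ^ 2) ^ 2 - 207 * (a * j ^ 2) + 572)).
  by rewrite e; ring.
have {e} [v3 [_ e]] := halve _ _ _ hb e.
have {e} [v4 [_ e]] := halve _ _ _ hb e.
by right; exists j, v4; split; [lia | cbv zeta; lia].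
Qed.

Ltac no_roots_mod m h f u y :=
  exfalso; apply: (no_roots m h f _ _ _ _ u y);
  [by [] | by congruence_mod | by congruence_mod | by vm_compute | ].

Ltac tangent_obstruction x0 y0 v0 ps ms h u v e :=
  exfalso; apply: (obstructedP 25 _ _ _ h x0 y0 v0 ps ms _ _ u v e);
  [by congruence_mod | by vm_compute].

(* The rational points on the conics come from a search for small ones. *)
Lemma exceptional_classes a b u v :
  In (a, b) (class_pairs 4873 [:: 2; 11; 13; 443]) ->
  25 * (a * u ^ 2) ^ 2 - 3312 * (a * u ^ 2) + 146432 = b * v ^ 2 ->
  exists k w, u = 4 * k /\ (a = 9746 /\ b = 2 \/ a = 5759 /\ b = 143) /\
    25 * (a * k ^ 2) ^ 2 - 207 * (a * k ^ 2) + 572 = b * w ^ 2.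
Proof.
move=> hab e.
have : In (a, b) [:: (1, 4873); (443, 11); (13, 63349); (5759, 143); (11, 443);
    (4873, 1); (143, 5759); (63349, 13); (2, 9746); (886, 22); (26, 126698);
    (11518, 286); (22, 886); (9746, 2); (286, 11518); (126698, 26)].
  by move: hab; vm_compute.
have local m : 0 < m -> insoluble m (fun u => a * u ^ 2)
    (fun x y => 25 * x ^ 2 - 3312 * x + 146432 - b * y ^ 2) (fun _ _ _ => 0) = true ->
    False.
  move=> m0 chk; apply: (no_roots m _ _ m0 _ _ chk u v); last by rewrite e Z.sub_diag.
  - by congruence_mod.
  - by congruence_mod.
(* For most pairs, reduction modulo 8 already excludes [u] odd and [u] twice odd. *)
have split4 : b mod 4 <> 0 ->
  insoluble 8 (fun k => a * (2 * k + 1) ^ 2)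
    (fun x y => 25 * x ^ 2 + - 3312 * x + 146432 - b * y ^ 2) (fun _ _ _ => 0) = true ->
  insoluble 8 (fun k => a * (2 * k + 1) ^ 2)
    (fun x y => 25 * x ^ 2 + - 828 * x + 9152 - b * y ^ 2) (fun _ _ _ => 0) = true ->
  exists k w, u = 4 * k /\
    25 * (a * k ^ 2) ^ 2 + - 207 * (a * k ^ 2) + 572 = b * w ^ 2.
  move=> b4 c1 c2; case: (two_adic_cases a b u v b4 e) => [[k e1]|[[k [w e1]]|]//];
    exfalso.
  - apply: (no_roots 8 _ _ _ _ _ c1 k v) => //; [by congruence_mod | by congruence_mod |].
    by rewrite e1 Z.sub_diag.
  - apply: (no_roots 8 _ _ _ _ _ c2 k w) => //; [by congruence_mod | by congruence_mod |].
    by rewrite e1 Z.sub_diag.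
case=> [[ea eb]|]; first subst a b.
  case: (two_adic_cases 1 4873 u v _ e) => [//|[k e1]|[[k [w e1]]|[k [w [_ e1]]]]].
  (* Odd [u] is soluble modulo 8 for this pair and needs a tangent of its own. The primes 113 and
     127 come from [4 * 25 * 572 - 207 ^ 2 = 113 * 127]; the other two quadratics multiply this by
     16 and 256. *)
  - tangent_obstruction 880 9 32 [:: 2; 11; 113; 127; 443]
      [:: 3; 32; 64; 121; 125] (fun k => 1 * (2 * k + 1) ^ 2) k v e1.
  - no_roots_mod 8 (fun k => 1 * (2 * k + 1) ^ 2)
      (fun x y => 25 * x ^ 2 + - 828 * x + 9152 - 4873 * y ^ 2) k w.
    by rewrite e1 Z.sub_diag.
  - tangent_obstruction 55 9 2 [:: 2; 11; 113; 127; 443]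
      [:: 8; 16; 3; 125; 121] (fun k => 1 * k ^ 2) k w e1.
case=> [[ea eb]|]; first subst a b.
  case: split4 => [|||k [w [_ e1]]]; [by [] | by vm_compute | by vm_compute |].
  tangent_obstruction 132 25 100 [:: 2; 5; 11; 113; 127]
      [:: 16; 32; 5; 443] (fun k => 443 * k ^ 2) k w e1.
case=> [[ea eb]|]; first subst a b.
  case: (two_adic_cases 13 63349 u v _ e) => [//|[k e1]|[[k [w e1]]|[k [w [_ e1]]]]].
  - no_roots_mod 8 (fun k => 13 * (2 * k + 1) ^ 2)
      (fun x y => 25 * x ^ 2 + - 3312 * x + 146432 - 63349 * y ^ 2) k v.
    by rewrite e1 Z.sub_diag.
  - tangent_obstruction (-352) 3 8 [:: 2; 11; 13; 113; 127; 443]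
      [:: 8; 16; 32; 3; 5; 13] (fun k => 13 * (2 * k + 1) ^ 2) k w e1.
  - tangent_obstruction 1159 93 16 [:: 2; 11; 13; 113; 127; 443]
      [:: 3; 4; 11; 13; 8; 16] (fun k => 13 * k ^ 2) k w e1.
case=> [[ea eb]|]; first subst a b.
  case: split4 => [|||k [w [eu e1]]]; [by [] | by vm_compute | by vm_compute |].
  by exists k, w; split=> //; split; [right | rewrite -e1; ring].
case=> [[ea eb]|]; first subst a b.
  by case: (local 121); vm_compute.
case=> [[ea eb]|]; first subst a b.
  by case: (local 443); vm_compute.
case=> [[ea eb]|]; first subst a b.
  case: split4 => [|||k [w [_ e1]]]; [by [] | by vm_compute | by vm_compute |].
  tangent_obstruction (-37) 2 3 [:: 2; 3; 13; 113; 127; 443]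
      [:: 3; 4; 5; 11; 13; 8; 16] (fun k => 143 * k ^ 2) k w e1.
case=> [[ea eb]|]; first subst a b.
  by case: (local 443); vm_compute.
case=> [[ea eb]|]; first subst a b.
  case: split4 => [|||k [w [_ e1]]]; [by [] | by vm_compute | by vm_compute |].
  tangent_obstruction (-243) 73 29 [:: 2; 11; 29; 113; 127; 443]
      [:: 4; 5; 8; 11] (fun k => 2 * k ^ 2) k w e1.
case=> [[ea eb]|]; first subst a b.
  by case: (local 443); vm_compute.
case=> [[ea eb]|]; first subst a b.
  case: split4 => [|||k [w [_ e1]]]; [by [] | by vm_compute | by vm_compute |].
  tangent_obstruction 308 139 6 [:: 2; 3; 11; 13; 113; 127; 443]
      [:: 5; 8; 13; 16; 121] (fun k => 26 * k ^ 2) k w e1.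
case=> [[ea eb]|]; first subst a b.
  by case: (local 443); vm_compute.
case=> [[ea eb]|]; first subst a b.
  case: split4 => [|||k [w [_ e1]]]; [by [] | by vm_compute | by vm_compute |].
  tangent_obstruction 191 69 32 [:: 2; 113; 127; 443]
      [:: 3; 4; 5; 8; 11] (fun k => 22 * k ^ 2) k w e1.
case=> [[ea eb]|]; first subst a b.
  case: split4 => [|||k [w [eu e1]]]; [by [] | by vm_compute | by vm_compute |].
  by exists k, w; split=> //; split; [left | rewrite -e1; ring].
case=> [[ea eb]|]; first subst a b.
  by case: (local 121); vm_compute.
case=> [[ea eb]|]; first subst a b.
  by case: (local 121); vm_compute.
by [].
Qed.

(** * The pair (5759, 143) *)

Lemma supported_subprods ps l p :
  for_all (supported ps) (subprods ps) = true -> for_all (fun l => 0 <? l) (subprods ps) = true ->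
  In l (subprods ps) -> prime p -> Z.divide p l -> In p ps.
Proof.
move=> /for_allP hps /for_allP hpos hl pp; apply: supportedP (hps l hl) _ pp.
by have /Z.ltb_lt := hpos l hl; lia.
Qed.

Lemma pell_ndvd p x s : prime p -> Z.divide p x -> Z.divide p s ->
  x ^ 2 - 3575 * s ^ 2 = 1 -> False.
Proof.
move=> pp dx ds e; apply: (prime_ndvd1 p pp); rewrite -e.
by rewrite !Z.pow_2_r; apply: Z.divide_sub_r;
  [apply: Z.divide_mul_l | apply/Z.divide_mul_r/Z.divide_mul_l].
Qed.

(** This is halving: [x + s sqrt 3575] is the square of [p + q sqrt 3575]. With [x = 2 h + 1], the
    coprime numbers [h + 1] and [h] have product [143 (5 k)^2], and only the classes 1 and 143
    survive modulo 11 and 13. *)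
Lemma pell_odd x s : 0 < x -> 0 < s -> x ^ 2 - 3575 * s ^ 2 = 1 -> Z.Odd x ->
  exists p q, 0 < p /\ 0 < q /\ x = 2 * p ^ 2 - 1 /\ s = 2 * p * q /\
    p ^ 2 - 3575 * q ^ 2 = 1.
Proof.
move=> x0 s0 e [h ex]; subst x.
have [k ek] : Z.Even s by case: (Z.Even_or_Odd s) => // -[k ek]; lia.
subst s.
have hk : (h + 1) * h = 143 * (5 * k) ^ 2 by lia.
have h0 : 0 < h by nia.
have [|||p pp|p pp d1 d2|e1 [e2 [P [Q [hin [P0 [Q0 [eP [eQ]]]]]]]]] :=
  square_classes [:: 11; 13] (h + 1) h 143 (5 * k) _ _ _ _ _ hk; try lia.
- by apply: supportedP pp; [vm_compute | ].
- case: (prime_ndvd1 p pp); have <- : (h + 1) - h = 1 by lia.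
  exact: Z.divide_sub_r.
have eq1 : e1 * P ^ 2 - e2 * Q ^ 2 - 1 = 0 by lia.
move: hin; rewrite -[class_pairs _ _]/([:: (1, 143); (13, 11); (11, 13); (143, 1)]).
case=> [[? ?]|]; first subst e1 e2; last first.
  case=> [[? ?]|]; first subst e1 e2; first by
    no_roots_mod 11 (fun x : Z => x) (fun x y => 13 * x ^ 2 - 11 * y ^ 2 - 1) P Q.
  case=> [[? ?]|]; first subst e1 e2; first by
    no_roots_mod 13 (fun x : Z => x) (fun x y => 11 * x ^ 2 - 13 * y ^ 2 - 1) P Q.
  case=> [[? ?]|//]; subst e1 e2; by
    no_roots_mod 11 (fun x : Z => x) (fun x y => 143 * x ^ 2 - 1 * y ^ 2 - 1) P Q.
rewrite -[Z.sqrt _]/143 => ePQ.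
have {}ePQ : P * Q = 5 * k by lia.
have [q eq] : Z.divide 5 Q.
  have : Z.divide 5 (P * Q) by exists k; lia.
  move=> /(prime_mult 5 (primebP 5 erefl))[[P1 eP1]|//].
  by no_roots_mod 5 (fun x => 5 * x) (fun x y => 1 * x ^ 2 - 143 * y ^ 2 - 1) P1 Q;
    rewrite -eq1 eP1; ring.
exists P, q; subst Q; split=> //; split; first lia.
by split; [lia | split; [lia | lia]].
Qed.

(** Now [x + 1] and [x - 1] are coprime with product [143 (5 s)^2]. Only the classes 13 and 11
    survive, and 5 must divide the second root, whence [275 = 11 * 5 ^ 2]. *)
Lemma pell_even x s : 0 < x -> 0 < s -> x ^ 2 - 3575 * s ^ 2 = 1 -> Z.Even x ->
  exists f g, 0 < f /\ 0 < g /\ x + 1 = 13 * f ^ 2 /\ x - 1 = 275 * g ^ 2 /\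
    s = f * g.
Proof.
move=> x0 s0 e [h ex].
have hx : (x + 1) * (x - 1) = 143 * (5 * s) ^ 2 by lia.
have [|||p pp|p pp d1 d2|e1 [e2 [f [g [hin [f0 [g0 [ef [eg]]]]]]]]] :=
  square_classes [:: 11; 13] (x + 1) (x - 1) 143 (5 * s) _ _ _ _ _ hx; try lia.
- by apply: supportedP pp; [vm_compute | ].
- have d3 : Z.divide p 2.
    have <- : (x + 1) - (x - 1) = 2 by lia.
    exact: Z.divide_sub_r.
  case: (prime_ndvd1 p pp); have <- : (x + 1) - 2 * h = 1 by lia.
  by apply: Z.divide_sub_r => //; apply: Z.divide_mul_l.
have eq1 : e1 * f ^ 2 - e2 * g ^ 2 - 2 = 0 by lia.
move: hin; rewrite -[class_pairs _ _]/([:: (1, 143); (13, 11); (11, 13); (143, 1)]).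
case=> [[? ?]|]; first subst e1 e2; first by
  no_roots_mod 11 (fun x : Z => x) (fun x y => 1 * x ^ 2 - 143 * y ^ 2 - 2) f g.
case=> [[? ?]|]; first subst e1 e2; last first.
  case=> [[? ?]|]; first subst e1 e2; first by
    no_roots_mod 11 (fun x : Z => x) (fun x y => 11 * x ^ 2 - 13 * y ^ 2 - 2) f g.
  case=> [[? ?]|//]; subst e1 e2; by
    no_roots_mod 13 (fun x : Z => x) (fun x y => 143 * x ^ 2 - 1 * y ^ 2 - 2) f g.
rewrite -[Z.sqrt _]/143 => efg.
have {}efg : f * g = 5 * s by lia.
have [g1 eg1] : Z.divide 5 g.
  have : Z.divide 5 (f * g) by exists s; lia.
  move=> /(prime_mult 5 (primebP 5 erefl))[[f1 ef1]|//].
  by no_roots_mod 5 (fun x => 5 * x) (fun x y => 13 * x ^ 2 - 11 * y ^ 2 - 2) f1 g;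
    rewrite -eq1 ef1; ring.
exists f, g1; subst g; split=> //; split; first lia.
by split; [lia | split; [lia | lia]].
Qed.

Notation bad_primes := [:: 2; 11; 443].

Lemma bad_primesP l p : In l (subprods bad_primes) -> prime p -> Z.divide p l ->
  In p bad_primes.
Proof. exact: supported_subprods. Qed.

Lemma class_pairs_in c ps l1 l2 : In (l1, l2) (class_pairs c ps) ->
  In l1 (subprods ps) /\ In l2 (subprods ps).
Proof. by move=> /filter_In[/in_prod_iff]. Qed.

Lemma subprods_bad_pos l : In l (subprods bad_primes) -> 0 < l.
Proof.
have /for_allP pos : for_all (fun l => 0 <? l) (subprods bad_primes) = true by [].
by move=> /pos/Z.ltb_lt.
Qed.

(** After halving, [s = (2 p) q] puts [2 p] and [q] in classes of [bad_primes]. Small moduli force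
    the class of [2 p] to be 2, so [p] is a square. *)
Lemma pell_descent x s l r : 0 < x -> 0 < s -> x ^ 2 - 3575 * s ^ 2 = 1 ->
  Z.Odd x -> In l (subprods bad_primes) -> s = l * r ^ 2 ->
  exists a q l' r', 0 < q /\ q < s /\ a ^ 4 - 3575 * q ^ 2 = 1 /\
    In l' (subprods bad_primes) /\ q = l' * r' ^ 2.
Proof.
move=> x0 s0 e ox hl es.
have [p [q [p0 [q0 [ex [epq e1]]]]]] := pell_odd x s x0 s0 e ox.
have e2 : (2 * p) * q = l * r ^ 2 by rewrite -es epq; ring.
have p20 : 0 < 2 * p by lia.
have [d dd dl|d dd dp dq|l1 [l2 [a [b [hin [_ [_ [ea [eb _]]]]]]]]] :=
  square_classes bad_primes (2 * p) q l r p20 q0 (subprods_bad_pos l hl) _ _ e2.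
- exact: bad_primesP hl dd dl.
- case/(prime_mult _ dd): dp => [d2|dp].
    by apply: (bad_primesP 2) => //; right; right; right; right; left.
  by case: (pell_ndvd d p q).
have [h1 h2] := class_pairs_in _ _ _ _ hin.
have e3 : (l1 * a ^ 2) ^ 2 - 14300 * q ^ 2 - 4 = 0 by rewrite -ea; lia.
have [m [[m0 ins]|l12]] : exists m, 0 < m /\ insoluble m (fun x : Z => x)
   (fun x y => (l1 * x ^ 2) ^ 2 - 14300 * y ^ 2 - 4) (fun _ _ _ => 0) = true
   \/ l1 = 2.
  move: h1; rewrite -[subprods _]/([:: 1; 443; 11; 4873; 2; 886; 22; 9746]).
  case=> [<-|]; first by exists 5; left; vm_compute.
  case=> [<-|]; first by exists 13; left; vm_compute.
  case=> [<-|]; first by exists 11; left; vm_compute.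
  case=> [<-|]; first by exists 11; left; vm_compute.
  case=> [<-|]; first by exists 1; right.
  case=> [<-|]; first by exists 5; left; vm_compute.
  case=> [<-|]; first by exists 11; left; vm_compute.
  by case=> [<-|//]; exists 11; left; vm_compute.
- by exfalso; apply: (no_roots m _ _ m0 _ _ ins a q e3); congruence_mod.
have ep : p = a ^ 2 by lia.
exists a, q, l2, b; split=> //; split.
  by rewrite epq -{1}(Z.mul_1_l q); apply: (proj1 (Z.mul_lt_mono_pos_r q 1 (2 * p) q0)); lia.
split=> //; rewrite -e1 ep; ring.
Qed.

(* Reduces to [a] even; then [a^2 + 1 = 13 f^2] with [f] odd and prime to [11]
   and [443], as [-1] is not a square modulo either; so [f] is a square, which
   fails modulo [5]. *)
Lemma pell_no_square a q l r : 0 < q -> a ^ 4 - 3575 * q ^ 2 = 1 ->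
  In l (subprods bad_primes) -> q = l * r ^ 2 -> False.
Proof.
move=> q0; have q1 : 0 <= q by lia.
move: q q1 q0 a l r; apply: Z_lt_induction => q IH q0 a l r e hl eq.
have a0 : 0 < a ^ 2 by nia.
have ea : (a ^ 2) ^ 2 - 3575 * q ^ 2 = 1 by rewrite -e; ring.
case: (Z.Even_or_Odd (a ^ 2)) => pa; last first.
  have [b [q' [l' [r' [q'0 [lt [e' [hl' eq']]]]]]]] :=
    pell_descent _ _ _ _ a0 q0 ea pa hl eq.
  exact: (IH q' ltac:(lia) q'0 b l' r').
have [f [g [f0 [g0 [ef [eg efg]]]]]] := pell_even _ _ a0 q0 ea pa.
have efg' : f * g = l * r ^ 2 by rewrite -efg.
have [d dd dl|d dd df dg|l1 [l2 [b [c [hin [_ [_ [eb _]]]]]]]] :=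
  square_classes bad_primes f g l r f0 g0 (subprods_bad_pos l hl) _ _ efg'.
- exact: bad_primesP hl dd dl.
- apply: (bad_primesP 2) => //; first by right; right; right; right; left.
  have <- : 13 * f * f - 275 * g * g = 2 by lia.
  by apply: Z.divide_sub_r; apply: Z.divide_mul_r.
have [h1 _] := class_pairs_in _ _ _ _ hin.
have [j ej] : Z.Even a.
  case: (Z.Even_or_Odd a) => // -[j ej]; case: pa => k; rewrite ej; lia.
have e1 : (2 * j) ^ 2 + 1 - 13 * (l1 * b ^ 2) ^ 2 = 0 by rewrite -eb -ej; lia.
have e2 : 13 * (l1 * b ^ 2) ^ 2 - 275 * g ^ 2 - 2 = 0.
  by rewrite -eb -ef -eg; ring.
move: h1; rewrite -[subprods _]/([:: 1; 443; 11; 4873; 2; 886; 22; 9746]).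
case=> [el|]; first subst l1.
  by no_roots_mod 5 (fun x : Z => x)
    (fun x y => 13 * (1 * x ^ 2) ^ 2 - 275 * y ^ 2 - 2) b g.
case=> [el|]; first subst l1.
  by no_roots_mod 443 (fun b => 13 * (443 * b ^ 2) ^ 2) (fun x y => (2 * y) ^ 2 + 1 - x) b j.
case=> [el|]; first subst l1.
  by no_roots_mod 11 (fun b => 13 * (11 * b ^ 2) ^ 2) (fun x y => (2 * y) ^ 2 + 1 - x) b j.
case=> [el|]; first subst l1.
  by no_roots_mod 11 (fun b => 13 * (4873 * b ^ 2) ^ 2) (fun x y => (2 * y) ^ 2 + 1 - x) b j.
case=> [el|]; first subst l1.
  by no_roots_mod 4 (fun b => 13 * (2 * b ^ 2) ^ 2) (fun x y => (2 * y) ^ 2 + 1 - x) b j.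
case=> [el|]; first subst l1.
  by no_roots_mod 4 (fun b => 13 * (886 * b ^ 2) ^ 2) (fun x y => (2 * y) ^ 2 + 1 - x) b j.
case=> [el|]; first subst l1.
  by no_roots_mod 4 (fun b => 13 * (22 * b ^ 2) ^ 2) (fun x y => (2 * y) ^ 2 + 1 - x) b j.
case=> [el|//]; subst l1.
by no_roots_mod 4 (fun b => 13 * (9746 * b ^ 2) ^ 2) (fun x y => (2 * y) ^ 2 + 1 - x) b j.
Qed.

(** A common prime of [s] and [4 x - 207 s] divides [4 x], hence is 2, since [x] and [s] are
    coprime; so [s] lies in a class of [bad_primes]. Odd [x] leads to [pell_no_square], even [x] to
    two equations without common solution modulo small numbers. *)
Lemma pell_quartic x s j : 0 < x -> 0 < s -> 0 < 4 * x - 207 * s ->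
  x ^ 2 - 3575 * s ^ 2 = 1 -> s * (4 * x - 207 * s) = 4873 * j ^ 2 -> False.
Proof.
move=> x0 s0 t0 e est; set t := 4 * x - 207 * s in t0 est.
have [d dd dl|d dd ds dt|c [c' [a [b [hin [_ [_ [ea [eb _]]]]]]]]] :=
  square_classes bad_primes s t 4873 j s0 t0 erefl _ _ est.
- by apply: supportedP dd dl; [vm_compute | ].
- have : Z.divide d (2 * 2 * x).
    have -> : 2 * 2 * x = t + 207 * s by rewrite /t; ring.
    by apply: Z.divide_add_r => //; apply: Z.divide_mul_r.
  move=> /(prime_mult _ dd)[/(prime_mult _ dd) d2|dx]; last by case: (pell_ndvd d x s).
  by apply: (bad_primesP 2) => //; [right; right; right; right; left | case: d2].
have [hc _] := class_pairs_in _ _ _ _ hin.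
case: (Z.Even_or_Odd x) => px; last first.
  have [p [q [l [r [q0 [_ [e' [hl eq]]]]]]]] := pell_descent _ _ _ _ x0 s0 e px hc ea.
  exact: pell_no_square q0 e' hl eq.
have [f [g [f0 [g0 [ef [eg efg]]]]]] := pell_even _ _ x0 s0 e px.
have efg' : f * g = c * a ^ 2 by rewrite -efg.
have [d dd dl|d dd df dg|l1 [l2 [u [v [hin' [_ [_ [eu [ev _]]]]]]]]] :=
  square_classes bad_primes f g c a f0 g0 (subprods_bad_pos c hc) _ _ efg'.
- exact: bad_primesP hc dd dl.
- apply: (bad_primesP 2) => //; first by right; right; right; right; left.
  have <- : 13 * f * f - 275 * g * g = 2 by lia.
  by apply: Z.divide_sub_r; apply: Z.divide_mul_r.
have e1 : 13 * (l1 * u ^ 2) ^ 2 - 275 * (l2 * v ^ 2) ^ 2 - 2 = 0.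
  by rewrite -eu -ev -ef -eg; ring.
(* Adding the equations of [pell_even] gives [4 x = 26 f^2 + 550 g^2], to be inserted in
   [t = 4 x - 207 s] with [s = f g]. *)
have e2 : 26 * (l1 * u ^ 2) ^ 2 + 550 * (l2 * v ^ 2) ^ 2
    - 207 * (l1 * u ^ 2) * (l2 * v ^ 2) - c' * b ^ 2 = 0.
  rewrite -eu -ev -eb /t efg.
  have -> : 26 * f ^ 2 = 2 * (13 * f ^ 2) by ring.
  have -> : 550 * g ^ 2 = 2 * (275 * g ^ 2) by ring.
  by rewrite -ef -eg; ring.
have chk : forallb (fun cc => forallb (fun l => for_some (fun m => (0 <? m) &&
    insoluble m (fun x : Z => x)
      (fun x y => 13 * (l.1 * x ^ 2) ^ 2 - 275 * (l.2 * y ^ 2) ^ 2 - 2)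
      (fun x y z => 26 * (l.1 * x ^ 2) ^ 2 + 550 * (l.2 * y ^ 2) ^ 2
         - 207 * (l.1 * x ^ 2) * (l.2 * y ^ 2) - cc.2 * z ^ 2))
    [:: 4; 5; 13; 16; 11; 37]) (class_pairs cc.1 bad_primes))
  (class_pairs 4873 bad_primes) = true by vm_compute.
move/forallb_forall: chk => /(_ _ hin)/forallb_forall/(_ _ hin')/for_someP.
move=> [m [_ /andP[/Z.ltb_lt m0 ins]]].
by apply: (insolubleP _ _ _ _ m0 _ _ _ ins u v b) => //; congruence_mod.
Qed.

Lemma quartic_143 k w :
  25 * (5759 * k ^ 2) ^ 2 - 207 * (5759 * k ^ 2) + 572 = 143 * w ^ 2 -> k = 0.
Proof.
move=> e.
(* The equation makes 11 divide [k^2 (25 * 5759 k^2 - 207)], whose second factor has no root modulo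
   11. *)
have [j ej] : Z.divide 11 k.
  have p11 := primebP 11 erefl.
  have : Z.divide 11 (k * k * (25 * 5759 * k ^ 2 - 207)).
    by apply: (Z.gauss _ 5759) => //; exists (13 * w ^ 2 - 52); lia.
  move=> /(prime_mult _ p11)[/(prime_mult _ p11)[]//|[y ey]].
  by no_roots_mod 11 (fun x : Z => x)
    (fun x y => 25 * 5759 * x ^ 2 - 207 - y * 11) k y; lia.
case: (Z.eq_dec j 0) => [j0|j0]; first by rewrite ej j0.
(* For [k = 11 j] one has [5759 k^2 = 143 z], and a factor 143 cancels from the equation. *)
exfalso; pose z := 4873 * j ^ 2.
have j2 : 0 < j ^ 2 by clear - j0; nia.
have z0 : 0 < z by rewrite /z; clear - j2; lia.
wlog w0 : w e / 0 < w.
  move=> H; apply: (H (Z.abs w)); first by rewrite abs_sqr.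
  by case: (Z.eq_dec w 0) e => [->|]; rewrite ?ej; [lia | lia].
have ew : w ^ 2 = 3575 * z ^ 2 - 207 * z + 4 by rewrite /z; rewrite ej in e; lia.
(* The factors are the tangents to [w^2 = 3575 z^2 - 207 z + 4] at the points [(z, w) = (0, -2)] and
   [(0, 2)]. *)
have eAB : (4 * w + 8 - 207 * z) * (4 * w - 8 + 207 * z) = 14351 * z ^ 2.
  have -> : (4 * w + 8 - 207 * z) * (4 * w - 8 + 207 * z) =
    16 * w ^ 2 - (207 * z - 8) ^ 2 by ring.
  by rewrite ew; ring.
have ez : z = 4873 * j ^ 2 by [].
clearbody z; clear e ej ew.
set B := 4 * w + 8 - 207 * z in eAB; set A := 4 * w - 8 + 207 * z in eAB.
have [B0 A0] : 0 < B /\ 0 < A.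
  have sAB : 0 < B + A by rewrite /A /B; clear - w0; lia.
  have pAB : 0 < B * A by rewrite eAB; clear - z0; nia.
  by clearbody A B; clear - sAB pAB; nia.
have dAB : B - A - 16 + 414 * z = 0 by rewrite /A /B; ring.
clearbody A B.
have [d dd dl|d dd dB dA|l1 [l2 [t [s [hin [t0 [s0 [et [es ets]]]]]]]]] :=
  square_classes [:: 2; 113; 127] B A 14351 z B0 A0 erefl _ _ eAB.
- by apply: supportedP dd dl; [vm_compute | ].
- have : Z.divide d (14351 * (z * z)).
    by rewrite -Z.pow_2_r -eAB; apply: Z.divide_mul_l.
  move=> /(prime_mult _ dd)[dl|dz].
    by apply: supportedP dd dl; [vm_compute | ].
  have {}dz : Z.divide d z by case/(prime_mult _ dd): dz.
  have d16 : Z.divide d 16.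
    have -> : 16 = B - A + 414 * z by clear - dAB; lia.
    by apply: Z.divide_add_r; [apply: Z.divide_sub_r | apply: Z.divide_mul_r].
  by apply: supportedP dd d16; [vm_compute | ].
rewrite (Z.abs_eq z) in ets; last by clear - z0; lia.
have e1 : 14351 * (l1 * t ^ 2 - l2 * s ^ 2 - 16) +
    414 * (Z.sqrt (14351 * l1 * l2) * (t * s)) = 0.
  by rewrite ets -et -es; clear - dAB; lia.
have [m [[m0 ins]|[? ?]]] : exists m, 0 < m /\ insoluble m (fun x : Z => x)
   (fun t s => 14351 * (l1 * t ^ 2 - l2 * s ^ 2 - 16) +
     414 * (Z.sqrt (14351 * l1 * l2) * (t * s))) (fun _ _ _ => 0) = true
   \/ l1 = 1 /\ l2 = 14351.
  move: hin; rewrite -[class_pairs _ _]/([:: (1, 14351); (127, 113); (113, 127);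
    (14351, 1); (2, 28702); (254, 226); (226, 254); (28702, 2)]).
  case=> [[<- <-]|]; first by exists 1; right.
  case=> [[<- <-]|]; first by exists 5; left; vm_compute.
  case=> [[<- <-]|]; first by exists 5; left; vm_compute.
  case=> [[<- <-]|]; first by exists 11; left; vm_compute.
  case=> [[<- <-]|]; first by exists 5; left; vm_compute.
  case=> [[<- <-]|]; first by exists 13; left; vm_compute.
  case=> [[<- <-]|]; first by exists 11; left; vm_compute.
  by case=> [[<- <-]|//]; exists 5; left; vm_compute.
- by apply: (no_roots m _ _ m0 _ _ ins t s e1); congruence_mod.
subst l1 l2; rewrite -[Z.sqrt _]/14351 in ets.
have {}ets : t * s = z by clear - ets; lia.
(* Completing the square in [t^2 + 414 t s - 14351 s^2 = 16], where [14351 + 207^2 = 16 * 3575]. *)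
have eX : (t + 207 * s) ^ 2 = 16 + 57200 * s ^ 2.
  by clear - e1; rewrite -[Z.sqrt _]/14351 in e1; lia.
have [x ex] : exists x, t + 207 * s = 4 * x.
  have [y [ey ey']] := halve 1 (t + 207 * s) (4 + 14300 * s ^ 2) ltac:(done) ltac:(lia).
  have [x [ex _]] := halve 1 y (1 + 3575 * s ^ 2) ltac:(done) ltac:(lia).
  by exists x; lia.
have et' : 4 * x - 207 * s = t by lia.
apply: (pell_quartic x s j); rewrite ?et' //.
- by clear - ex t0 s0; lia.
- by rewrite ex in eX; clear - eX; lia.
- by rewrite Z.mul_comm ets.
Qed.

(** * The pair (9746, 2) *)

(* The classes modulo [35] of the points of [X^2 + 14351 = 2 Y^2]: a set closed
   under sign changes and under multiplication of [X + Y sqrt 2] by the unit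
   [3 + 2 sqrt 2]. *)
Definition pell_class (X Y : Z) : bool :=
  existsb (fun p => (p.1 =? X mod 35) && (p.2 =? Y mod 35))
    [:: (1, 6); (1, 29); (6, 1); (6, 34); (8, 15); (8, 20); (13, 15); (13, 20);
        (14, 9); (14, 16); (14, 19); (14, 26); (21, 9); (21, 16); (21, 19);
        (21, 26); (22, 15); (22, 20); (27, 15); (27, 20); (29, 1); (29, 34);
        (34, 6); (34, 29)].

Lemma pell_class_cong X Y X' Y' : cong 35 X X' -> cong 35 Y Y' ->
  pell_class X Y = pell_class X' Y'.
Proof.
have mod_eq x x' : cong 35 x x' -> x mod 35 = x' mod 35.
  move=> [k hk]; have -> : x = x' + k * 35 by lia.
  exact: Z.mod_add.
by move=> /mod_eq hX /mod_eq hY; rewrite /pell_class hX hY.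
Qed.

Lemma pell_class_closed X Y : pell_class X Y = true ->
  pell_class (- X) Y = true /\ pell_class X (- Y) = true /\
  pell_class (3 * X + 4 * Y) (3 * Y + 2 * X) = true.
Proof.
have hX : cong 35 X (X mod 35) by apply: cong_mod.
have hY : cong 35 Y (Y mod 35) by apply: cong_mod.
rewrite (pell_class_cong _ _ _ _ hX hY).
rewrite -!(Z.sub_0_l) (pell_class_cong (0 - X) Y (0 - X mod 35) (Y mod 35));
  [|by congruence_mod..].
rewrite (pell_class_cong X (0 - Y) (X mod 35) (0 - Y mod 35));
  [|by congruence_mod..].
rewrite (pell_class_cong (3 * X + 4 * Y) (3 * Y + 2 * X)
  (3 * (X mod 35) + 4 * (Y mod 35)) (3 * (Y mod 35) + 2 * (X mod 35)));
  [|by congruence_mod..].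
have := mod_residues 35 X erefl; have := mod_residues 35 Y erefl.
move: (X mod 35) (Y mod 35) => x y hy hx h.
have chk : for_all (fun x => for_all (fun y => if pell_class x y then
    [&& pell_class (0 - x) y, pell_class x (0 - y) &
      pell_class (3 * x + 4 * y) (3 * y + 2 * x)] else true)
  (residues 35)) (residues 35) = true by vm_compute.
have {chk} := for_allP _ _ _ (for_allP _ _ _ chk hx) hy.
by rewrite h => /and3P[h1 h2 h3]; split; [exact: h1 | split; [exact: h2 | exact: h3]].
Qed.

(** Descent by the inverse unit [3 - 2 sqrt 2]. Since [119^2 < 14351 < 120^2], [X >= 120] gives
    [Y < X < 2 Y], hence [|3 X - 4 Y| < X]; smaller solutions are enumerated. *)
Lemma pell_class_all X Y : X ^ 2 + 14351 = 2 * Y ^ 2 -> pell_class X Y = true.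
Proof.
have nonneg n : 0 <= n -> forall X Y, X = n -> 0 <= X -> 0 <= Y ->
    X ^ 2 + 14351 = 2 * Y ^ 2 -> pell_class X Y = true.
  move: n; apply: Z_lt_induction => n IH {}X {}Y eX X0 Y0 e.
  case: (Z_le_gt_dec X 119) => hX.
    have chk : for_all (fun x => for_all (fun y =>
        if x ^ 2 + 14351 =? 2 * y ^ 2 then pell_class x y else true)
      (residues 121)) (residues 121) = true by vm_compute.
    have Y120 : Y <= 120 by nia.
    have := for_allP _ _ _ (for_allP _ _ _ chk (in_residues 121 X ltac:(lia)))
      (in_residues 121 Y ltac:(lia)).
    by rewrite (proj2 (Z.eqb_eq _ _) e).
  have YX : Y < X by nia.
  have XY : X < 2 * Y by nia.
  have Y'0 : 0 <= 3 * Y - 2 * X by nia.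
  have h : pell_class (3 * X - 4 * Y) (3 * Y - 2 * X) = true.
    have e' : Z.abs (3 * X - 4 * Y) ^ 2 + 14351 = 2 * (3 * Y - 2 * X) ^ 2.
      by rewrite abs_sqr; lia.
    have h := IH (Z.abs (3 * X - 4 * Y)) ltac:(lia) _ _ erefl (Z.abs_nonneg _) Y'0 e'.
    case: (Z.abs_spec (3 * X - 4 * Y)) h => -[_ ->] // /pell_class_closed[h _].
    by rewrite -(Z.opp_involutive (3 * X - 4 * Y)).
  have [_ [_]] := pell_class_closed _ _ h.
  have -> : 3 * (3 * X - 4 * Y) + 4 * (3 * Y - 2 * X) = X by ring.
  by have -> : 3 * (3 * Y - 2 * X) + 2 * (3 * X - 4 * Y) = Y by ring.
move=> e; have {e} h : pell_class (Z.abs X) (Z.abs Y) = true.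
  by apply: (nonneg (Z.abs X)) => //; [lia | lia | lia | rewrite !abs_sqr].
have {}h : pell_class X (Z.abs Y) = true.
  case: (Z.abs_spec X) h => -[_ ->] // /pell_class_closed[h _].
  by rewrite -(Z.opp_involutive X).
case: (Z.abs_spec Y) h => -[_ ->] // /pell_class_closed[_ [h _]].
by rewrite -(Z.opp_involutive Y).
Qed.

(** With [x = 9746 k^2], completing the square gives [100 (25 x^2 - 207 x + 572) = (50 x - 207)^2 +
    14351], which equals [2 (10 w)^2]. *)
Lemma quartic_2 k w :
  25 * (9746 * k ^ 2) ^ 2 - 207 * (9746 * k ^ 2) + 572 = 2 * w ^ 2 -> False.
Proof.
move=> e.
have : pell_class (487300 * k ^ 2 - 207) (10 * w) = true.
  by apply: pell_class_all; lia.
rewrite (pell_class_cong _ _ (487300 * (k mod 35) ^ 2 - 207) (10 * (w mod 35))).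
- have := mod_residues 35 k erefl; have := mod_residues 35 w erefl.
  move: (k mod 35) (w mod 35) => x y hy hx h.
  have chk : for_all (fun x => for_all (fun y =>
      ~~ pell_class (487300 * x ^ 2 - 207) (10 * y)) (residues 35))
    (residues 35) = true by vm_compute.
  by have := for_allP _ _ _ (for_allP _ _ _ chk hx) hy; rewrite h.
- have := cong_mod 35 k erefl; by congruence_mod.
- have := cong_mod 35 w erefl; by congruence_mod.
Qed.

(** * Integral and rational points *)

(** A common prime of [M] and the quadratic factor divides [146432 = 2^10 * 11 * 13]; together with
    [4873 = 11 * 443] this bounds the square classes. *)
Lemma integral_points M D : 4873 * D ^ 2 = M * (25 * M ^ 2 - 3312 * M + 146432) ->
  M = 0.
Proof.
move=> e; case: (Z.eq_dec M 0) => // M0.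
have Q0 : 0 < 25 * M ^ 2 - 3312 * M + 146432.
  by clear; have := Z.square_nonneg (25 * M - 1656); lia.
have {M0} Mpos : 0 < M.
  have : 0 <= M * (25 * M ^ 2 - 3312 * M + 146432) by rewrite -e; nia.
  by clear e; nia.
exfalso; set Q := 25 * M ^ 2 - 3312 * M + 146432 in e Q0.
have [d dd dl|d dd dM dQ|a [b [u [v [hin [u0 [_ [eM [eQ _]]]]]]]]] :=
  square_classes [:: 2; 11; 13; 443] M Q 4873 D Mpos Q0 erefl _ _ (esym e).
- by apply: supportedP dd dl; [vm_compute | ].
- have d0 : Z.divide d 146432.
    have -> : 146432 = Q - M * (25 * M - 3312) by rewrite /Q; ring.
    by apply: Z.divide_sub_r => //; apply: Z.divide_mul_l.
  by apply: supportedP dd d0; [vm_compute | ].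
have eab : 25 * (a * u ^ 2) ^ 2 - 3312 * (a * u ^ 2) + 146432 = b * v ^ 2.
  by rewrite -eM -eQ.
have [k [w [eu [[[? ?]|[? ?]] ekw]]]] := exceptional_classes a b u v hin eab; subst a b.
  exact: quartic_2 ekw.
by move: u0; rewrite eu (quartic_143 k w ekw) => /Z.lt_irrefl.
Qed.

Lemma rational_points M n q : q <> 0 ->
  4873 * (n * n) = M * (25 * (M * M) - 3312 * M + 146432) * (q * q) -> M = 0.
Proof.
move=> q0 e; set F := M * (25 * (M * M) - 3312 * M + 146432) in e.
have [|r [_ er]] := square_quotient (4873 * F) q (4873 * n) q0; first lia.
have divr p k : prime p -> 4873 = p * k -> Z.divide p r.
  move=> pp ep; have : Z.divide p (r * r) 
    by exists (k * F); rewrite -Z.pow_2_r -er ep; ring.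
  by case/(prime_mult _ pp).
have [s es] := divr 443 11 (primebP 443 erefl) erefl.
have [t et] : Z.divide 11 s.
  have [t et] := divr 11 443 (primebP 11 erefl) erefl.
  (* The witness comes from [4 * 443 - 161 * 11 = 1]. *)
  by exists (4 * t - 161 * s); lia.
by apply: (integral_points M t); rewrite /F in er; lia.
Qed.

From mathcomp Require Import ring.
Local Close Scope Z_scope.
Local Open Scope ring_scope.

(** Here [n / q] stands for [384 d], as [384^2 = 2^14 * 3^2], and the shift by 48 moves the root
    [L = -48] of the cubic to 0. *)
Lemma shifted_cubic (R : comNzRingType) (L n q : int) (d : R) :
  n%:~R = 384 * d * q%:~R ->
  2 ^+ 14 * 3 ^+ 2 * 11 * 443 * d ^+ 2 =
    5 ^+ 2 * L%:~R ^+ 3 + 2 ^+ 5 * 3 ^+ 2 * L%:~R ^+ 2 + 2 ^+ 8 * 5 * L%:~R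
    + 2 ^+ 16 * 3 * 11 ->
  (11 * 443 * (n * n))%:~R = ((L + 48) * (25 * ((L + 48) * (L + 48))
    - 16 * 207 * (L + 48) + 32 * 32 * 143) * (q * q))%:~R :> R.
Proof.
move=> en e.
have -> : (11 * 443 * (n * n))%:~R = 11 * 443 * (n%:~R * n%:~R) :> R by ring.
have -> : 11 * 443 * (n%:~R * n%:~R) =
    2 ^+ 14 * 3 ^+ 2 * 11 * 443 * d ^+ 2 * q%:~R ^+ 2 :> R by rewrite en; ring.
by rewrite e; ring.
Qed.

Lemma cubic_at_root (R : numDomainType) (d : R) :
  2 ^+ 14 * 3 ^+ 2 * 11 * 443 * d ^+ 2 =
    5 ^+ 2 * (-48)%:~R ^+ 3 + 2 ^+ 5 * 3 ^+ 2 * (-48)%:~R ^+ 2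
    + 2 ^+ 8 * 5 * (-48)%:~R + 2 ^+ 16 * 3 * 11 -> d = 0.
Proof.
move=> e; have /eqP : 2 ^+ 14 * 3 ^+ 2 * 11 * 443 * d ^+ 2 = 0 :> R.
  by rewrite e; ring.
have c0 : 2 ^+ 14 * 3 ^+ 2 * 11 * 443 != 0 :> R.
  by do 3 ?[apply: mulf_neq0]; rewrite ?expf_neq0 ?pnatr_eq0.
by rewrite mulf_eq0 (negPf c0) sqrf_eq0 => /eqP.
Qed.

(* Solutions (L, d) in Z x Q of
   2^14*3^2*11*443 d^2 = 5^2 L^3 + 2^5*3^2 L^2 + 2^8*5 L + 2^16*3*11
   are exactly L = -48, d = 0. *)
Theorem theorem8p1 :
  forall (L : int) (d : rat),
    (2 ^+ 14 * 3 ^+ 2 * 11 * 443 * d ^+ 2 =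
       5 ^+ 2 * (L%:~R) ^+ 3 + 2 ^+ 5 * 3 ^+ 2 * (L%:~R) ^+ 2
       + 2 ^+ 8 * 5 * (L%:~R) + 2 ^+ 16 * 3 * 11 :> rat)
    <-> (L = -48 /\ d = 0).
Proof.
move=> L d; split=> [e|[-> ->]]; last first.
  by rewrite mulrNz; ring.
have eL : L = -48.
  pose r : rat := 384 * d; pose n := numq r; pose q := denq r.
  have q0 : q%:~R != 0 :> rat by rewrite intr_eq0 denq_neq0.
  have eint : 11 * 443 * (n * n) = (L + 48) *
      (25 * ((L + 48) * (L + 48)) - 16 * 207 * (L + 48) + 32 * 32 * 143) * (q * q).
    apply: (@intr_inj rat); apply: (shifted_cubic _ _ _ _ d _ e).
    exact: numqE.
  have h := rational_points (Z_of_int (L + 48)) (Z_of_int n) (Z_of_int q).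
  have qz : q <> 0 by move=> qz; rewrite qz in q0.
  lia.
by split; [ | rewrite eL in e; exact: cubic_at_root e].
Qed.
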